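(* For all integers $n\ge0$ and $r\ge 0$, $$E_{n,r}(x)=a_n(x)+(1-x)\sum_{i=1}^r C_{i-1}\,a_{n-i}(x),$$ where $a_j(x)=0$ for $j<0$.
   Context: For $n\ge0$, $a_n(x)=\sum_{\pi\in S_n(321)}x^{f(\pi)}$, where $S_n(321)$ is the set of permutations $\pi=\pi_1\cdots\pi_n$ of $\{1,\dots,n\}$ with no indices $i<j<l$ such that $\pi_i>\pi_j>\pi_l$, and $f(\pi)$ is the number of fixed points ($i$ with $\pi_i=i$). For integers $n\ge0$, $r$, let $\mathcal E_{n,r}$ be the set of bijections $\pi:\{1,\dots,n\}\to\{r+1,\dots,r+n\}$ such that the word $\pi(1)\pi(2)\cdots\pi(n)$ avoids $132$ (no $i<j<l$ with $\pi(i)<\pi(l)<\pi(j)$), and $E_{n,r}(x)=\sum_{\pi\in\mathcal E_{n,r}}x^{f(\pi)}$ where $f(\pi)$ is the number of $i$ with $\pi(i)=i$. $C_m=\frac1{m+1}\binom{2m}{m}$ is the $m$-th Catalan number. *)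

(* Defs.v *)
From HB Require Import structures.
From mathcomp Require Import all_boot all_order all_algebra all_fingroup.

Set Implicit Arguments.
Unset Strict Implicit.
Unset Printing Implicit Defensive.

Import GRing.Theory.
Local Open Scope ring_scope.

(* The index set {1, ..., n} is represented by 'I_n, the ordinal i standing for
   i.+1.  A bijection {1, ..., n} -> {r+1, ..., r+n} is represented by the
   permutation s with pi(i.+1) = r + (s i).+1; [word r s] is the word
   pi(1) ... pi(n).  The case r = 0 gives the permutations of {1, ..., n}. *)
Definition word (n : nat) (r : int) (s : 'S_n) (i : 'I_n) : int :=
  r + ((s i).+1)%:Z.

Definition fixpts (n : nat) (w : 'I_n -> int) : nat :=
  #|[set i : 'I_n | w i == (i.+1)%:Z]|.

Definition avoids321 (n : nat) (w : 'I_n -> int) : bool :=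
  ~~ [exists i : 'I_n, exists j : 'I_n, exists l : 'I_n,
       [&& (i < j)%N, (j < l)%N, w j < w i & w l < w j]].

Definition avoids132 (n : nat) (w : 'I_n -> int) : bool :=
  ~~ [exists i : 'I_n, exists j : 'I_n, exists l : 'I_n,
       [&& (i < j)%N, (j < l)%N, w i < w l & w l < w j]].

Definition fix321 (n : nat) : {poly int} :=
  \sum_(s : 'S_n | avoids321 (word 0 s)) 'X^(fixpts (word 0 s)).

(* a_j(x), extended by 0 to negative indices *)
Definition a (j : int) : {poly int} :=
  match j with
  | Posz n => fix321 n
  | Negz _ => 0
  end.

Definition E (n : nat) (r : int) : {poly int} :=
  \sum_(s : 'S_n | avoids132 (word r s)) 'X^(fixpts (word r s)).

(* the division is exact *)
Definition catalan (m : nat) : nat := ('C(m.*2, m) %/ m.+1)%N.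

(* Main.v *)
Require Import Defs.
From HB Require Import structures.
From mathcomp Require Import all_boot all_order all_algebra all_fingroup.
From mathcomp Require Import zify ring.

(* A 132-avoiding word of length n+1 is u n v with every letter of u larger than
   every letter of v, and a fixed point requires the shifts of u and v to be
   small: at most one of the factors u, n, v can contain fixed points. By
   induction this gives, for every integer r,
     E_(n,r) = C_n + (x - 1) sum_(j < n, j >= |r|) C_j E_(n-1-j,0).
   In a 321-avoiding permutation a fixed point i separates the smaller letters
   from the larger ones; expanding x^f - 1 over the fixed points gives
     a_n = C_n + (x - 1) sum_(j < n) C_j a_(n-1-j),
   where the count C_n of 321-avoiders comes from the generating tree that
   inserts a new least letter. Hence E_(n,0) = a_n, and the theorem is the
   difference of the two formulas. *)

Set Implicit Arguments.
Unset Strict Implicit.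
Unset Printing Implicit Defensive.

Import GRing.Theory Num.Theory.
Local Open Scope ring_scope.

(** * Ballot numbers and their Catalan convolution *)

Section Ballot.
Local Open Scope nat_scope.

(* The m-th coefficient of C(z)^(l+1), where C is the Catalan generating
   function; the recursion counts the nodes at depth m of the generating tree
   in which a node labelled l has children labelled 1, ..., l+1. *)
Fixpoint ballot (m l : nat) : nat :=
  if m is m'.+1 then \sum_(1 <= i < l.+2) ballot m' i else 1.

Lemma ballotS0 m : ballot m.+1 0 = ballot m 1.
Proof. by rewrite /= big_nat1. Qed.

Lemma ballotSS m l : ballot m.+1 l.+1 = ballot m.+1 l + ballot m l.+2.
Proof. by rewrite /= big_nat_recr. Qed.

(** Pascal's rule matches [ballotSS], and the symmetry of an odd row settles [l = 0]; the additive
    form avoids truncated subtraction. *)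
Lemma ballot_binS m l :
  ballot m.+1 l + 'C(m.+1.*2 + l, m) = 'C(m.+1.*2 + l, m.+1).
Proof.
elim: m l => [|m IHm]; elim=> [|l IHl].
- by rewrite ballotS0.
- by rewrite ballotSS addnS binS bin0 -IHl bin0 addnAC.
- have := IHm 1.
  rewrite addn1 [ballot m.+2 0]ballotS0 addn0 [m.+2.*2]doubleS => e1.
  have e2 : 'C(m.+1.*2.+1, m.+2) = 'C(m.+1.*2.+1, m.+1).
    by rewrite -bin_sub; [congr 'C(_, _); lia | lia].
  have := binS m.+1.*2.+1 m; have := binS m.+1.*2.+1 m.+1; move: e1 e2.
  set b := ballot _ _; set x1 := 'C(_, m.+2); set x2 := 'C(_, m.+1); lia.
- have := IHm l.+2; have -> : m.+1.*2 + l.+2 = m.+2.*2 + l by lia.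
  have := binS (m.+2.*2 + l) m.+1; have := binS (m.+2.*2 + l) m.
  by rewrite [ballot m.+2 _]ballotSS addnS; lia.
Qed.

Lemma ballot_catalan m : ballot m 0 = catalan m.
Proof.
rewrite /catalan; case: m => [|m]; first by rewrite /= bin0 divn1.
have := ballot_binS m 0; rewrite addn0 => hb.
have hm := mul_bin_left m.+1.*2 m.
(* Eliminating ['C(m.+1.*2, m)] between [hb] and [hm] gives this, so the division in [catalan] is
   exact. *)
suff -> : 'C(m.+1.*2, m.+1) = ballot m.+1 0 * m.+2 by rewrite mulnK.
have e : m.+1.*2 - m = m.+2 by lia.
rewrite e in hm; move: hb hm; set B := ballot _ _; nia.
Qed.

(** This is C(z)^(l+2) = C(z)^(l+1) C(z) on coefficients; the case l = 0 gives the Catalan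
    recurrence. *)
Lemma ballot_conv m l :
  ballot m l.+1 = \sum_(i < m.+1) ballot i l * ballot (m - i) 0.
Proof.
elim: m l => [|m IHm] l; first by rewrite big_ord1.
elim: l => [|l IHl].
  rewrite big_ord_recl subn0 mul1n ballotSS; congr (_ + _).
  by rewrite IHm; apply: eq_bigr => i _; rewrite ballotS0.
rewrite ballotSS IHl IHm [in RHS]big_ord_recl [X in X + _]big_ord_recl.
rewrite -addnA -big_split; congr (_ + _).
by apply: eq_bigr => i _; rewrite !lift0 ballotSS mulnDl.
Qed.

Lemma ballotS_conv q :
  ballot q.+1 0 = \sum_(i < q.+1) ballot i 0 * ballot (q - i) 0.
Proof. by rewrite ballotS0 ballot_conv. Qed.

End Ballot.

(** * Conditions on all triples of a word *)

Section Triplewise.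
Variable T : Type.
Implicit Types (q : T -> rel T) (u v w : seq T).

Fixpoint triplewise q w :=
  if w is x :: w' then pairwise (q x) w' && triplewise q w' else true.

(** A triple of positions in [u ++ v] has three, none, one or two members in [u]; these are the four
    conjuncts. *)
Lemma triplewise_cat q u v :
  triplewise q (u ++ v) =
  [&& triplewise q u, triplewise q v, all (fun x => pairwise (q x) v) u
    & pairwise (fun x y => all (q x y) v) u].
Proof.
elim: u => [|x u IHu] /=; first by rewrite !andbT.
rewrite IHu pairwise_cat /allrel.
case: (all (fun y => all (q x y) v) u); rewrite /= ?andbF //.
case: (pairwise (q x) u) => //=; case: (pairwise (q x) v); rewrite //= ?andbF //.
Qed.

Lemma eq_triplewise q1 q2 w :
  (forall x y z, q1 x y z = q2 x y z) -> triplewise q1 w = triplewise q2 w.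
Proof.
move=> eq12; elim: w => //= x w ->; congr (_ && _).
by apply: eq_pairwise => y z; apply: eq12.
Qed.

Lemma triplewiseP x0 q w :
  reflect (forall i j l, (i < j)%N -> (j < l)%N -> (l < size w)%N ->
             q (nth x0 w i) (nth x0 w j) (nth x0 w l))
          (triplewise q w).
Proof.
elim: w => [|x w IHw] /=; first by constructor.
apply: (iffP andP) => [[/(pairwiseP x0) qx /IHw qw]|qw].
  case=> [|i] [|j] // [|l] // lt_ij lt_jl lt_l; last exact: qw.
  by apply: (qx j l) => //; rewrite inE; lia.
split; last by apply/IHw => i j l ? ? ?; apply: (qw i.+1 j.+1 l.+1).
by apply/(pairwiseP x0) => j l _ lt_l lt_jl; apply: (qw 0%N j.+1 l.+1).
Qed.

End Triplewise.

Lemma triplewise_map T S (f : T -> S) (q : S -> rel S) (w : seq T) :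
  triplewise q (map f w) = triplewise (fun x y z => q (f x) (f y) (f z)) w.
Proof. by elim: w => //= x w ->; rewrite pairwise_map. Qed.

Lemma pairwise_in (T : eqType) (r : rel T) (s : seq T) :
  {in s &, forall x y, r x y} -> pairwise r s.
Proof.
elim: s => //= x s IHs rs; apply/andP; split.
  by apply/allP => y sy; apply: rs; rewrite !inE ?eqxx ?sy ?orbT.
by apply: IHs => y z sy sz; apply: rs; rewrite inE ?sy ?sz orbT.
Qed.

(** * Pattern-avoiding words on 0, ..., n-1 *)

Section Avoiders.
Local Open Scope nat_scope.
Implicit Types (u v w : seq nat) (q : nat -> rel nat).

Definition no321 (x y z : nat) := ~~ ((y < x) && (z < y)).
Definition no132 (x y z : nat) := ~~ ((x < z) && (z < y)).

Definition avoiders q n := [seq w <- permutations (iota 0 n) | triplewise q w].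

Lemma mem_avoiders q n w :
  (w \in avoiders q n) = triplewise q w && perm_eq w (iota 0 n).
Proof. by rewrite mem_filter mem_permutations. Qed.

Lemma avoiders_uniq q n : uniq (avoiders q n).
Proof. by rewrite filter_uniq ?permutations_uniq. Qed.

Lemma avoiders_size q n w : w \in avoiders q n -> size w = n.
Proof. by rewrite mem_avoiders => /andP[_ /perm_size->]; rewrite size_iota. Qed.

Lemma triplewise321_addn k w :
  triplewise no321 (map (addn k) w) = triplewise no321 w.
Proof.
by rewrite triplewise_map; apply: eq_triplewise => x y z; rewrite /no321 !ltn_add2l.
Qed.

Lemma triplewise132_addn k w :
  triplewise no132 (map (addn k) w) = triplewise no132 w.
Proof.
by rewrite triplewise_map; apply: eq_triplewise => x y z; rewrite /no132 !ltn_add2l.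
Qed.

(** Because [u] lies below [v], sorting each factor sorts the whole word; the result is [iota 0 n],
    cut at [size u]. *)
Lemma perm_iota_cat n u v :
  perm_eq (u ++ v) (iota 0 n) -> allrel ltn u v ->
  perm_eq u (iota 0 (size u)) /\ perm_eq v (iota (size u) (size v)).
Proof.
move=> eq_uv /allrelP lt_uv.
have nE : n = size u + size v by rewrite -size_cat (perm_size eq_uv) size_iota.
have : sort leq u ++ sort leq v = iota 0 n.
  apply: (sorted_eq leq_trans anti_leq); last 1 first.
  - by apply: perm_trans eq_uv; apply: perm_cat; rewrite perm_sort.
  - rewrite (sorted_pairwise leq_trans) pairwise_cat -!(sorted_pairwise leq_trans).
    rewrite !(sort_sorted leq_total) !andbT; apply/allrelP => x y.
    by rewrite !mem_sort => ux vy; apply/ltnW/lt_uv.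
  - exact: iota_sorted.
rewrite nE iotaD => /eqP; rewrite eqseq_cat ?size_sort ?size_iota //.
by case/andP=> /eqP<- /eqP<-; rewrite ![perm_eq _ (sort _ _)]perm_sym !perm_sort.
Qed.

Lemma perm_iota_shift k m v :
  perm_eq v (iota k m) ->
  exists2 v', v = map (addn k) v' & perm_eq v' (iota 0 m).
Proof.
move=> eq_v; exists (map (subn^~ k) v).
  rewrite -map_comp map_id_in // => x; rewrite (perm_mem eq_v) mem_iota /=; lia.
have := perm_map (subn^~ k) eq_v; rewrite -[in iota k m](addn0 k) iotaDl -map_comp.
by rewrite [map (_ \o _) _]map_id_in // => x _ /=; rewrite addKn.
Qed.

Lemma perm_addn k m v :
  perm_eq (map (addn k) v) (iota k m) = perm_eq v (iota 0 m).
Proof.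
rewrite -[in iota k m](addn0 k) iotaDl.
by apply/idP/idP => [/(perm_map_inj (@addnI k))|/perm_map->].
Qed.

End Avoiders.

(** * Splitting avoiders at the greatest letter or at a fixed point *)

Section Glue.
Local Open Scope nat_scope.
Implicit Types (u v w : seq nat) (q : nat -> rel nat).

Lemma perm_cat_max n u v :
  perm_eq (u ++ n :: v) (iota 0 n.+1) = perm_eq (u ++ v) (iota 0 n).
Proof.
rewrite -[n.+1 in LHS]addn1 iotaD /= add0n perm_sym perm_catC perm_sym.
by rewrite -cat1s perm_catCA /= perm_cons.
Qed.

(** If x in [u] is less than z in [v], then x, n, z form a 132. When [v] lies below [u], a 132
    cannot meet two of the three factors. *)
Lemma triplewise132_glue n u v :
  all (fun x => x < n) u -> all (fun x => x < n) v -> uniq (u ++ v) ->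
  triplewise no132 (u ++ n :: v) =
  [&& triplewise no132 u, triplewise no132 v & allrel ltn v u].
Proof.
move=> /allP un /allP vn uniq_uv; rewrite triplewise_cat /=.
have [_ {uniq_uv}/hasPn dis _] := and3P (etrans (esym (cat_uniq u v)) uniq_uv).
have -> : pairwise (no132 n) v.
  by apply: pairwise_in => y z _ /vn; rewrite /no132; lia.
case: (triplewise no132 u) => //=; case: (triplewise no132 v) => //=.
apply/andP/allrelP => [[/allP qu _] z x zv xu|lt_vu].
  have /andP[/allP/(_ z zv) + _] := qu x xu.
  have : z != x by apply: contraNneq (dis _ zv) => ->.
  by have := vn z zv; rewrite /no132 /=; lia.
split; last first.
  apply: pairwise_in => x y ux uy; apply/andP; split.
    by have := un y uy; rewrite /no132; lia.
  by apply/allP => z zv; have := lt_vu z x zv ux; rewrite /no132 /=; lia.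
apply/allP => x ux; apply/andP; split.
  by apply/allP => z zv; have := lt_vu z x zv ux; rewrite /no132 /=; lia.
by apply: pairwise_in => y z _ zv; have := lt_vu z x zv ux; rewrite /no132 /=; lia.
Qed.

(** Letters only grow from [u] to [i] to [v], so a decreasing triple must stay inside [u] or inside
    [v]. *)
Lemma triplewise321_glue i u v :
  all (fun x => x < i) u -> all (fun x => i < x) v ->
  triplewise no321 (u ++ i :: v) = triplewise no321 u && triplewise no321 v.
Proof.
move=> /allP ui /allP vi; rewrite triplewise_cat /=.
have -> : pairwise (no321 i) v.
  by apply: pairwise_in => y z /vi + _; rewrite /no321; lia.
case: (triplewise no321 u) => //=; case: (triplewise no321 v) => //=.
apply/andP; split.
  apply/allP => x /ui xi; apply/andP; split.
    by apply/allP => z _; rewrite /no321; lia.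
  by apply: pairwise_in => y z /vi + _; rewrite /no321; lia.
apply: pairwise_in => x y /ui xi /ui yi; apply/andP; split.
  by rewrite /no321; lia.
by apply/allP => z /vi; rewrite /no321; lia.
Qed.

(* Exactly i letters are smaller than i; so if a letter larger than i came
   before i, then a letter smaller than i would come after it. *)
Lemma fixed_split321 n i u v :
  perm_eq (u ++ i :: v) (iota 0 n) -> size u = i ->
  triplewise no321 (u ++ i :: v) ->
  all (fun x => x < i) u /\ all (fun x => i < x) v.
Proof.
move=> eq_w size_u; rewrite triplewise_cat => /and4P[_ _ /allP qu _].
have : uniq (u ++ i :: v) by rewrite (perm_uniq eq_w) iota_uniq.
rewrite cat_uniq /= negb_or => /and3P[_ /andP[iu _] /andP[iv _]].
have count_i : count (gtn i) u + count (gtn i) v = i.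
  have /seq.permP/(_ (gtn i)) := eq_w; rewrite count_cat /= ltnn add0n => ->.
  have lt_in : i < n.
    have : i \in iota 0 n by rewrite -(perm_mem eq_w) mem_cat mem_head orbT.
    by rewrite mem_iota.
  have := congr1 size (filter_iota_ltn 0 (ltnW lt_in)).
  by rewrite size_filter size_iota.
have neq_u x : x \in u -> x != i by apply: contraTneq => ->.
have neq_v x : x \in v -> x != i by apply: contraTneq => ->.
have [lt_v|no_lt_v] := boolP (has (gtn i) v).
  have lt_u : all (gtn i) u.
    have /hasP[y yv /= lt_yi] := lt_v; apply/allP => x xu /=.
    have /= /andP[/allP/(_ y yv) + _] := qu x xu.
    by have := neq_u x xu; rewrite /no321; lia.
  by move: lt_u lt_v count_i; rewrite all_count has_count => /eqP; lia.
move: (no_lt_v) count_i; rewrite has_count => no_v count_u; split.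
  by rewrite -[all _ _]/(all (gtn i) u) all_count; apply/eqP; lia.
apply/allP => y yv; have /hasPn/(_ y yv) := no_lt_v.
by have := neq_v y yv; rewrite /=; lia.
Qed.

(** The letters before [n] exceed those after it, so the position [k] of [n] forces [v] to use the
    letters below [n - k] and [u] the next [k] letters. *)
Lemma avoiders132_index n k : k <= n ->
  perm_eq [seq w <- avoiders no132 n.+1 | index n w == k]
    [seq map (addn (n - k)) u ++ n :: v |
       u <- avoiders no132 k, v <- avoiders no132 (n - k)].
Proof.
move=> le_kn; apply: uniq_perm.
- by rewrite filter_uniq ?avoiders_uniq.
- apply: allpairs_uniq; rewrite ?avoiders_uniq // => -[u v] [u' v'] /=.
  move=> /allpairsP[[x y] /= [/avoiders_size sx _ [-> ->]]].
  move=> /allpairsP[[x' y'] /= [/avoiders_size sx' _ [-> ->]]] /eqP.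
  rewrite eqseq_cat ?size_map ?sx ?sx' // => /andP[/eqP/(inj_map (@addnI _)) ->].
  by move=> /eqP[->].
move=> w; rewrite mem_filter mem_avoiders.
apply/idP/allpairsP => [/and3P[/eqP w_k tw pw]|[[u v] /= [+ + ->]]].
  have nw : n \in w by rewrite (perm_mem pw) mem_iota /= add0n.
  case/splitPr: nw w_k tw pw => u v + tw pw.
  have : uniq (u ++ n :: v) by rewrite (perm_uniq pw) iota_uniq.
  rewrite cat_uniq /= negb_or index_cat /= eqxx addn0.
  move=> /and3P[_ /andP[/negPf-> _] _] size_u.
  have p_uv : perm_eq (u ++ v) (iota 0 n) by rewrite -perm_cat_max.
  have lt_uv x : x \in u ++ v -> x < n by rewrite (perm_mem p_uv) mem_iota.
  move: tw; rewrite triplewise132_glue; first last.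
  - by rewrite (perm_uniq p_uv) iota_uniq.
  - by apply/allP => x xv; apply: lt_uv; rewrite mem_cat xv orbT.
  - by apply/allP => x xu; apply: lt_uv; rewrite mem_cat xu.
  case/and3P=> tu tv lt_vu.
  have := p_uv; rewrite perm_catC => /perm_iota_cat/(_ lt_vu)[pv pu].
  have size_v : size v = n - k.
    by rewrite -size_u -(size_iota 0 n) -(perm_size p_uv) size_cat addKn.
  rewrite size_u size_v in pu; rewrite size_v in pv.
  have [u' uE pu'] := perm_iota_shift pu.
  exists (u', v); split; rewrite /= ?mem_avoiders ?tv ?uE //.
  by rewrite -(triplewise132_addn (n - k)) -uE tu.
rewrite !mem_avoiders => /andP[tu pu] /andP[tv pv].
have su := perm_size pu; have sv := perm_size pv; rewrite !size_iota in su sv.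
have pu' : perm_eq (map (addn (n - k)) u) (iota (n - k) k) by rewrite perm_addn.
have p_uv : perm_eq (map (addn (n - k)) u ++ v) (iota 0 n).
  rewrite -[in iota 0 n](subnK le_kn) iotaD perm_sym perm_catC perm_sym.
  exact: perm_cat.
have lt_vn x : x \in v -> x < n - k by rewrite (perm_mem pv) mem_iota.
have lt_un x : x \in map (addn (n - k)) u -> n - k <= x < n.
  by rewrite (perm_mem pu') mem_iota; lia.
rewrite triplewise132_glue; first last.
- by rewrite (perm_uniq p_uv) iota_uniq.
- by apply/allP => x /lt_vn; lia.
- by apply/allP => x /lt_un; lia.
rewrite triplewise132_addn tu tv /= index_cat /= eqxx addn0 size_map su.
rewrite (negPf (_ : n \notin _)) ?eqxx /=; last first.
  by apply/negP => /lt_un; lia.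
apply/andP; split.
  by apply/allrelP => x y /lt_vn + /lt_un /=; lia.
by rewrite perm_cat_max.
Qed.

End Glue.

Section Fixed321.
Local Open Scope nat_scope.

(** By [fixed_split321] the smaller letters fill the first [i] positions, so the two sides can be
    relabelled and chosen independently. *)
Lemma avoiders321_fixed n i : i < n ->
  perm_eq [seq w <- avoiders no321 n | nth 0 w i == i]
    [seq u ++ i :: map (addn i.+1) v |
       u <- avoiders no321 i, v <- avoiders no321 (n - i.+1)].
Proof.
move=> lt_in; apply: uniq_perm.
- by rewrite filter_uniq ?avoiders_uniq.
- apply: allpairs_uniq; rewrite ?avoiders_uniq // => -[u v] [u' v'] /=.
  move=> /allpairsP[[x y] /= [/avoiders_size sx _ [-> ->]]].
  move=> /allpairsP[[x' y'] /= [/avoiders_size sx' _ [-> ->]]] /eqP.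
  rewrite eqseq_cat ?sx ?sx' // => /andP[/eqP->].
  by move=> /eqP[/(inj_map (@addnI _)) ->].
have iotaE : iota 0 n = iota 0 i ++ i :: iota i.+1 (n - i.+1).
  have {1}-> : n = i + (n - i.+1).+1 by lia.
  by rewrite iotaD add0n.
move=> w; rewrite mem_filter mem_avoiders.
apply/idP/allpairsP => [/and3P[/eqP w_i tw pw]|[[u v] /= [+ + ->]]].
  have size_w : size w = n by rewrite (perm_size pw) size_iota.
  have wE : w = take i w ++ i :: drop i.+1 w.
    by rewrite -{2}w_i -drop_nth ?cat_take_drop ?size_w.
  have size_u : size (take i w) = i by rewrite size_takel // size_w ltnW.
  have size_v : size (drop i.+1 w) = n - i.+1 by rewrite size_drop size_w.
  move: (take i w) (drop i.+1 w) wE size_u size_v => u v wE size_u size_v.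
  rewrite {}wE in tw pw *.
  have [lt_u lt_v] := fixed_split321 pw size_u tw.
  move: tw; rewrite triplewise321_glue // => /andP[tu tv].
  have [|pu pv] := perm_iota_cat pw.
    apply/allrelP => x y /(allP lt_u) xi; rewrite inE /= => /predU1P[->//|].
    by move=> /(allP lt_v); apply: ltn_trans.
  rewrite size_u /= size_v perm_cons in pu pv.
  have [v' vE pv'] := perm_iota_shift pv.
  exists (u, v'); split; rewrite /= ?mem_avoiders ?tu ?vE //.
  by rewrite -(triplewise321_addn i.+1) -vE tv.
rewrite !mem_avoiders => /andP[tu pu] /andP[tv pv].
have su := perm_size pu; rewrite size_iota in su.
have pv' : perm_eq (map (addn i.+1) v) (iota i.+1 (n - i.+1)).
  by rewrite perm_addn.
rewrite nth_cat su ltnn subnn eqxx /= triplewise321_glue.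
- by rewrite triplewise321_addn tu tv iotaE /= perm_cat ?perm_cons.
- by apply/allP => x; rewrite (perm_mem pu) mem_iota.
- by apply/allP => x; rewrite (perm_mem pv') mem_iota => /andP[].
Qed.

End Fixed321.

(** * Generating tree counting the 321-avoiders *)

Section Count321.
Local Open Scope nat_scope.
Implicit Types (u v w : seq nat).

Fixpoint ascent_run_from x w :=
  if w is y :: w' then if x < y then (ascent_run_from y w').+1 else 0 else 0.

(** This is the label in the generating tree: a new least letter may go exactly at the positions 0,
    ..., [ascent_run w]. *)
Definition ascent_run w :=
  if w is x :: w' then (ascent_run_from x w').+1 else 0.

Lemma sorted_take_run p w :
  p <= size w -> sorted ltn (take p w) = (p <= ascent_run w).
Proof.
case: w p => [|x w] [|p] //=.
elim: w x p => [|y w IHw] x [|p] //= le_p.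
by case: (x < y); rewrite //= IHw.
Qed.

Lemma ascent_run_size w : ascent_run w <= size w.
Proof.
case: w => //= x w; elim: w x => //= y w IHw x; case: ifP => // _; exact: IHw.
Qed.

Definition insert0 p w := take p (map S w) ++ 0 :: drop p (map S w).

(** In front, 0 lengthens the initial run; after p > 0 increasing letters it creates a descent and
    stops the run at p. *)
Lemma ascent_run_insert0 p w : p <= ascent_run w ->
  ascent_run (insert0 p w) = if p is 0 then (ascent_run w).+1 else p.
Proof.
rewrite /insert0; case: p => [_|p le_p].
  rewrite take0 drop0; case: w => //= x w; congr _.+2.
  by elim: w x => //= y w IHw x; rewrite ltnS IHw.
case: w le_p => //= x w; rewrite ltnS => le_p; congr _.+1.
elim: w x p le_p => [|y w IHw] x [|p] //=.
by rewrite ltnS; case: ifP => // _ /IHw ->.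
Qed.

(** Nothing lies below 0, so in a 321 it could only be the last letter; the only new obstruction is
    therefore an inversion in [u]. *)
Lemma triplewise321_insert0 u v : uniq u -> all (ltn 0) u ->
  triplewise no321 (u ++ 0 :: v) = sorted ltn u && triplewise no321 (u ++ v).
Proof.
move=> uniq_u /allP u_gt0.
rewrite ltn_sorted_uniq_leq uniq_u (sorted_pairwise leq_trans) !triplewise_cat /=.
have -> : pairwise (no321 0) v by apply: pairwise_in => y z _ _; rewrite /no321.
have -> : all (fun x => all (no321 x 0) v && pairwise (no321 x) v) u =
          all (fun x => pairwise (no321 x) v) u.
  apply: eq_in_all => x _; rewrite (_ : all _ _) //; apply/allP => z _.
  by rewrite /no321 ltn0 andbF.
have -> : pairwise (fun x y => no321 x y 0 && all (no321 x y) v) u =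
          pairwise leq u && pairwise (fun x y => all (no321 x y) v) u.
  rewrite -pairwise_relI; apply: eq_in_pairwise (introT allP u_gt0) => x y _ /=.
  by rewrite unfold_in => y_gt0; rewrite /no321; case: leqP; rewrite ?y_gt0.
case: (triplewise no321 u) => //=; case: (triplewise no321 v); rewrite ?andbF //=.
by case: (all _ u); rewrite ?andbF.
Qed.

Lemma avoiders321_insert n p : p <= n ->
  perm_eq [seq w <- avoiders no321 n.+1 | index 0 w == p]
    [seq insert0 p w | w <- avoiders no321 n & p <= ascent_run w].
Proof.
move=> le_pn.
have memP w : w \in avoiders no321 n -> p <= size w by move=> /avoiders_size->.
apply: uniq_perm; first by rewrite filter_uniq ?avoiders_uniq.
  rewrite map_inj_in_uniq ?(filter_uniq _ (avoiders_uniq _ _)) // => w w'.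
  rewrite !(mem_filter _ _ (avoiders _ _)).
  move=> /andP[_ /memP le_p] /andP[_ /memP le_p'] /eqP.
  rewrite eqseq_cat ?size_takel ?size_map // => /andP[/eqP eq_t /eqP[eq_d]].
  apply: (inj_map succn_inj).
  by rewrite -(cat_take_drop p (map S w)) eq_t eq_d cat_take_drop.
have sorted_S w : sorted ltn (map S w) = sorted ltn w by rewrite sorted_map.
have perm0 u v : perm_eq (u ++ 0 :: v) (iota 0 n.+1) = perm_eq (u ++ v) (iota 1 n).
  by rewrite -cat1s perm_catCA /= perm_cons.
move=> w; rewrite mem_filter mem_avoiders.
apply/idP/mapP => [/and3P[/eqP w_p tw pw]|[w']].
  have w0 : 0 \in w by rewrite (perm_mem pw) mem_iota.
  have : uniq w by rewrite (perm_uniq pw) iota_uniq.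
  case/splitPr: w0 w_p tw pw => u v + tw pw.
  rewrite cat_uniq /= negb_or index_cat /= addn0.
  move=> + /and3P[uniq_u /andP[u0 _] _]; rewrite (negPf u0) => size_u.
  move: pw; rewrite perm0 => /perm_iota_shift[w' uvE pw'].
  move: tw; rewrite triplewise321_insert0 // => [/andP[su tw']|]; last first.
    by apply/allP => x; case: x => //= /(negP u0).
  have sw' : size w' = n by rewrite (perm_size pw') size_iota.
  exists w'; last first.
    by rewrite /insert0 -[map S w']uvE -size_u take_size_cat ?drop_size_cat.
  rewrite mem_filter mem_avoiders pw' -(triplewise321_addn 1) -uvE tw' !andbT.
  rewrite -sorted_take_run ?sw' // -sorted_S map_take -[map S w']uvE -size_u.
  by rewrite take_size_cat.
rewrite mem_filter => /andP[le_p w'_av]; have := w'_av; rewrite mem_avoiders.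
move=> /andP[tw' pw'] ->; have le_ps := memP _ w'_av.
have map_gt0 : all (ltn 0) (map S w') by rewrite all_map; apply/allP.
have uniq_map : uniq (map S w').
  by rewrite (map_inj_uniq succn_inj) (perm_uniq pw') iota_uniq.
rewrite /insert0 perm0 cat_take_drop -[map S w']/(map (addn 1) w').
rewrite perm_addn pw' andbT.
rewrite triplewise321_insert0 ?take_uniq //; last first.
  by apply/allP => x /mem_take; apply: (allP map_gt0).
rewrite cat_take_drop triplewise321_addn tw' andbT -map_take sorted_S.
rewrite sorted_take_run // le_p andbT index_cat.
rewrite ifN; first by rewrite size_map size_takel //= addn0.
by apply/mapP => -[].
Qed.

(** Each word is weighted by the number of its descendants [m] levels deeper; going one level down
    while lowering [m] preserves the total. At [m = 0] all weights are 1. *)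
Lemma sum_ballot_avoiders321 m n :
  \sum_(w <- avoiders no321 n) ballot m (ascent_run w) = ballot (m + n) 0.
Proof.
elim: n m => [|n IHn] m; first by rewrite big_seq1 addn0.
rewrite addnS -addSn -IHn.
rewrite (partition_big (fun w => inord (index 0 w) : 'I_n.+1) xpredT) //=.
transitivity (\sum_(p < n.+1) \sum_(w <- avoiders no321 n | p <= ascent_run w)
                ballot m (ascent_run (insert0 p w))).
  apply: eq_bigr => p _; rewrite -[RHS]big_filter.
  rewrite -(big_map (insert0 p) xpredT (fun w => ballot m (ascent_run w))).
  rewrite -(perm_big _ (avoiders321_insert (ltn_ord p : p <= n))) /= big_filter.
  rewrite big_seq_cond [RHS]big_seq_cond; apply: eq_bigl => w.
  case: (boolP (w \in _)) => //= w_av; rewrite -val_eqE /= inordK //.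
  rewrite -(avoiders_size w_av) index_mem.
  by move: w_av; rewrite mem_avoiders => /andP[_ /perm_mem->]; rewrite mem_iota.
rewrite (exchange_big_dep xpredT) //= !big_seq; apply: eq_bigr => w w_av.
have le_run : (ascent_run w).+1 <= n.+1.
  by rewrite ltnS -(avoiders_size w_av) ascent_run_size.
rewrite -(big_ord_widen_cond _ xpredT
            (fun p => ballot m (ascent_run (insert0 p w))) le_run).
(* [p = 0] yields the largest label, [(ascent_run w).+1], so it is matched with the last term of the
   sum defining [ballot m.+1]. *)
rewrite big_ord_recl ascent_run_insert0 //= big_nat_recr //= addnC; congr (_ + _).
rewrite big_add1 big_mkord; apply: eq_bigr => p _.
by rewrite ascent_run_insert0.
Qed.

Lemma size_avoiders321 n : size (avoiders no321 n) = ballot n 0.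
Proof. by rewrite -[n in RHS]add0n -sum_ballot_avoiders321 /= sum1_size. Qed.

End Count321.

(** * Fixed points of shifted words *)

Section FixedPoints.
Implicit Types (r : int) (u v w : seq nat).

(* The number of positions i (counted from 0) of w with r + w_i = i. *)
Fixpoint nfix r w : nat :=
  if w is x :: w' then ((r + x%:Z == 0)%R + nfix (r - 1)%R w')%N else 0%N.

Lemma nfix_cat r u v : nfix r (u ++ v) = (nfix r u + nfix (r - (size u)%:Z)%R v)%N.
Proof.
elim: u r => [|x u IHu] r /=; first by rewrite subr0.
by rewrite IHu addnA; congr (_ + nfix _ _)%N; lia.
Qed.

Lemma nfix_addn k r w : nfix r (map (addn k) w) = nfix (r + k%:Z) w.
Proof.
elim: w r => //= x w IHw r; rewrite IHw; congr (nat_of_bool _ + nfix _ _)%N; lia.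
Qed.

Lemma nfixE r w :
  nfix r w = (\sum_(i < size w) (r + (nth 0%N w i)%:Z == i%:Z)%R)%N.
Proof.
elim: w r => [|x w IHw] r /=; first by rewrite big_ord0.
rewrite big_ord_recl IHw; congr (_ + _)%N; apply: eq_bigr => i _.
by rewrite lift0 /=; congr nat_of_bool; lia.
Qed.

(* X^f - 1 = (X - 1)(1 + X + ... + X^(f-1)), the exponents counting the fixed
   points to the right of a given one. *)
Lemma expX_nfix r w :
  'X^(nfix r w) = 1 + ('X - 1) *
    \sum_(i < size w | r + (nth 0%N w i)%:Z == i%:Z)
      'X^(nfix (r - i.+1%:Z) (drop i.+1 w)) :> {poly int}.
Proof.
elim: w r => [|x w IHw] r /=; first by rewrite big_ord0 mulr0 addr0.
rewrite exprD big_mkcond big_ord_recl /= drop0.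
have -> : \sum_(i < size w)
    (if r + (nth 0%N (x :: w) (lift ord0 i))%:Z == (lift ord0 i)%:Z then
       'X^(nfix (r - (lift ord0 i).+1%:Z) (drop (lift ord0 i).+1 (x :: w)))
     else 0) =
  \sum_(i < size w | r - 1 + (nth 0%N w i)%:Z == i%:Z)
      'X^(nfix (r - 1 - i.+1%:Z) (drop i.+1 w)) :> {poly int}.
  rewrite [RHS]big_mkcond; apply: eq_bigr => i _; rewrite lift0 /=.
  have -> : (r + (nth 0%N w i)%:Z == i.+1%:Z) = (r - 1 + (nth 0%N w i)%:Z == i%:Z).
    by lia.
  by have -> : r - i.+2%:Z = r - 1 - i.+1%:Z by lia.
rewrite IHw; set S := \sum_(i < _ | _) _.
by case: eqP => _; rewrite /= ?expr0 ?expr1; ring.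
Qed.

End FixedPoints.

(** * Passing from permutations to words *)

Section Encoding.
Variable n : nat.
Implicit Types (s : 'S_n) (r : int).

Definition pword s : seq nat := [seq nat_of_ord (s i) | i <- enum 'I_n].

Lemma size_pword s : size (pword s) = n.
Proof. by rewrite size_map size_enum_ord. Qed.

Lemma nth_pword s (i : 'I_n) : nth 0%N (pword s) i = s i.
Proof. by rewrite (nth_map i) ?size_enum_ord // nth_ord_enum. Qed.

Lemma big_pword (Q : pred (seq nat)) (F : seq nat -> {poly int}) :
  \sum_(s : 'S_n | Q (pword s)) F (pword s) =
  \sum_(w <- permutations (iota 0 n) | Q w) F w.
Proof.
rewrite -(big_map pword Q F); apply: perm_big.
have inj : injective pword.
  move=> s t eq_st; apply/permP => i; apply: val_inj.
  by rewrite /= -!nth_pword eq_st.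
have uniq_im : uniq (map pword (index_enum 'S_n)).
  by rewrite map_inj_uniq ?index_enum_uniq.
apply: uniq_perm; rewrite ?permutations_uniq //.
(* [pword] is injective and both sides have n! elements, so inclusion already gives equality. *)
apply: (uniq_min_size uniq_im _ _).2.
  move=> _ /mapP[s _ ->]; rewrite mem_permutations.
  apply: uniq_perm; rewrite ?iota_uniq //.
    by rewrite map_inj_uniq ?enum_uniq // => i j /val_inj/perm_inj.
  move=> x; rewrite mem_iota /= add0n; apply/mapP/idP => [[i _ ->] //|lt_xn].
  by exists ((s^-1)%g (Ordinal lt_xn)); rewrite ?mem_enum // permKV.
rewrite size_permutations ?iota_uniq // size_iota size_map.
by rewrite -[index_enum _]/(Finite.enum _) -enumT -cardT card_Sn.
Qed.

Lemma fixpts_word r s : fixpts (word r s) = nfix r (pword s).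
Proof.
rewrite nfixE size_pword /fixpts -sum1dep_card big_mkcond /=.
apply: eq_bigr => i _; rewrite nth_pword /word.
have -> : (r + ((s i).+1)%:Z == (i.+1)%:Z) = (r + (s i)%:Z == i%:Z) by lia.
by case: eqP.
Qed.

Lemma triplewise_pword (q : nat -> rel nat) s (b : 'I_n -> 'I_n -> 'I_n -> bool) :
  (forall i j l, b i j l = ~~ q (s i) (s j) (s l)) ->
  ~~ [exists i : 'I_n, exists j : 'I_n, exists l : 'I_n,
       [&& (i < j)%N, (j < l)%N & b i j l]] = triplewise q (pword s).
Proof.
move=> bE; apply/negP/(triplewiseP 0%N) => [no i j l lt_ij lt_jl|av].
  rewrite size_pword => lt_ln.
  have lt_jn := ltn_trans lt_jl lt_ln; have lt_in := ltn_trans lt_ij lt_jn.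
  have := nth_pword s (Ordinal lt_in); have := nth_pword s (Ordinal lt_jn).
  have := nth_pword s (Ordinal lt_ln); rewrite /= => -> -> ->.
  apply/negPn/negP => nq; apply: no; apply/existsP; exists (Ordinal lt_in).
  apply/existsP; exists (Ordinal lt_jn); apply/existsP; exists (Ordinal lt_ln).
  by rewrite bE; apply/and3P.
case/existsP=> i /existsP[j /existsP[l /and3P[lt_ij lt_jl]]].
have := av i j l lt_ij lt_jl; rewrite size_pword ltn_ord !nth_pword => /(_ isT).
by rewrite bE => ->.
Qed.

Lemma avoids321_word r s : avoids321 (word r s) = triplewise no321 (pword s).
Proof.
by apply: triplewise_pword => i j l; rewrite negbK /word !ltrD2l !ltz_nat !ltnS.
Qed.

Lemma avoids132_word r s : avoids132 (word r s) = triplewise no132 (pword s).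
Proof.
by apply: triplewise_pword => i j l; rewrite negbK /word !ltrD2l !ltz_nat !ltnS.
Qed.

Lemma E_avoiders r : E n r = \sum_(w <- avoiders no132 n) 'X^(nfix r w).
Proof.
rewrite big_filter -big_pword; apply: eq_big => [s|s _].
  exact: avoids132_word.
by rewrite fixpts_word.
Qed.

Lemma fix321_avoiders : fix321 n = \sum_(w <- avoiders no321 n) 'X^(nfix 0 w).
Proof.
rewrite big_filter -big_pword; apply: eq_big => [s|s _].
  exact: avoids321_word.
by rewrite fixpts_word.
Qed.

End Encoding.

(** * Recurrences for both polynomials and the formula for [E] *)

Section Recurrences.
Implicit Types (n : nat) (r : int).

Local Notation c j := (ballot j 0).

(* A 132-avoiding word of length n+1 is u n v with every letter of u larger
   than every letter of v. *)
Lemma E_rec n r :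
  E n.+1 r = \sum_(k < n.+1) 'X^(r + n%:Z == k%:Z) *
    (E k (r + (n - k)%N%:Z) * E (n - k) (r - k.+1%:Z)).
Proof.
rewrite E_avoiders.
rewrite (partition_big (fun w => inord (index n w) : 'I_n.+1) xpredT) //=.
apply: eq_bigr => k _.
have le_kn : (k <= n)%N by rewrite -ltnS.
transitivity (\sum_(w <- [seq w <- avoiders no132 n.+1 | index n w == k])
                'X^(nfix r w) : {poly int}).
  rewrite big_filter big_seq_cond [RHS]big_seq_cond; apply: eq_bigl => w.
  case: (boolP (w \in _)) => //= w_av; rewrite -val_eqE /= inordK //.
  rewrite -(avoiders_size w_av) index_mem.
  by move: w_av; rewrite mem_avoiders => /andP[_ /perm_mem->]; rewrite mem_iota /=.
rewrite (perm_big _ (avoiders132_index le_kn)) /= big_allpairs_dep.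
rewrite !E_avoiders big_distrlr mulr_sumr big_seq [RHS]big_seq.
apply: eq_bigr => u /avoiders_size size_u; rewrite mulr_sumr.
(* [u] starts at position 0 with letters raised by n - k, [n] stands at position k, and [v] starts
   at position k + 1. *)
apply: eq_bigr => v _; rewrite nfix_cat size_map size_u /= nfix_addn.
have -> : (r - k%:Z + n%:Z == 0) = (r + n%:Z == k%:Z) by lia.
have -> : r - k%:Z - 1 = r - k.+1%:Z by lia.
by rewrite !exprD; ring.
Qed.

Lemma fix321_rec n :
  fix321 n = (c n)%:R +
    ('X - 1) * \sum_(i < n) (c i)%:R * fix321 (n - i.+1).
Proof.
rewrite fix321_avoiders (eq_bigr _ (fun w _ => expX_nfix 0 w)) big_split /=.
rewrite big_const_seq count_predT size_avoiders321 iter_addr_0 -mulr_sumr.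
congr (_ + _ * _).
transitivity (\sum_(w <- avoiders no321 n) \sum_(i < n | nth 0%N w i == i)
    'X^(nfix (- i.+1%:Z) (drop i.+1 w)) : {poly int}).
  rewrite big_seq [RHS]big_seq; apply: eq_bigr => w /avoiders_size->.
  by apply: eq_big => [i|i _]; rewrite ?add0r ?eqz_nat // sub0r.
(* With the fixed point [i] chosen first, the left factor is only counted, because the exponent sees
   only the fixed points to the right of [i]. *)
rewrite (exchange_big_dep xpredT) //=; apply: eq_bigr => i _.
rewrite -big_filter (perm_big _ (avoiders321_fixed (ltn_ord i))) /=.
rewrite big_allpairs_dep fix321_avoiders -size_avoiders321 -sum1_size natr_sum.
rewrite mulr_suml big_seq [RHS]big_seq; apply: eq_bigr => u /avoiders_size size_u.
rewrite mul1r; apply: eq_bigr => v _.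
rewrite -cat_rcons drop_size_cat ?size_rcons ?size_u // nfix_addn.
by rewrite addNr.
Qed.

(* The coefficients of E p 0 on the two sides of E_rec. Put q = n - p; if
   -q < r <= q, then for each splitting of q - 1 exactly one of the two
   conditions on r in the sum holds. *)
Lemma ballot_coef n p r : (p <= n)%N ->
  (\sum_(k < n.+1)
     (((p < k) && (`|(r + (n - k)%N%:Z)%R| <= k - p.+1)) * c (k - p.+1) * c (n - k)
      + c k * (((p < n - k) && (`|(r - k.+1%:Z)%R| <= n - k - p.+1))
               * c (n - k - p.+1)))
   + (r + n%:Z == p%:Z)%R * c (n - p) = (`|r| <= n - p) * c (n - p))%N.
Proof.
move=> le_pn; rewrite big_split /=.
pose f k := (((p < k) && (`|(r + (n - k)%N%:Z)%R| <= k - p.+1)) *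
             c (k - p.+1) * c (n - k))%N.
pose g k := (c k * (((p < n - k) && (`|(r - k.+1%:Z)%R| <= n - k - p.+1)) *
                    c (n - k - p.+1)))%N.
rewrite -(big_mkord xpredT f) -(big_mkord xpredT g) {}/f {}/g.
(* The first sum starts at k = p + 1 and the second stops at k = n - p - 1; shifting the first lets
   both run over the same q indices j. *)
rewrite (@big_cat_nat _ _ _ p.+1) //=.
rewrite (@big_cat_nat _ _ _ (n - p) 0%N n.+1) //=; last by lia.
rewrite [X in (X + _ + _ + _)%N]big_nat.
rewrite [X in (X + _ + _ + _)%N]big1 => [|k /=]; last first.
  by move=> lt_k; rewrite ltnNge (_ : (k <= p)%N) //; lia.
rewrite [X in (_ + (_ + X) + _)%N]big_nat.
rewrite [X in (_ + (_ + X) + _)%N]big1 => [|k /=]; last first.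
  move=> lt_k; rewrite [(p < _)%N]ltnNge (_ : (n - k <= p)%N); last by lia.
  by rewrite /= muln0.
rewrite add0n addn0 -{1}[p.+1]add0n big_addn subSS -big_split big_mkord /=.
set q := (n - p)%N.
(* For each j the conditions read 1 - q <= r <= 2j + 1 - q and 2j + 2 - q <= r <= q: disjoint
   intervals with union [b]. *)
pose b := ((- q%:Z < r)%R && (r <= q%:Z)%R).
rewrite (eq_bigr (fun j : 'I_q => b * (c j * c (q - j.+1)))%N); last first.
  move=> j _; have lt_jq := ltn_ord j.
  have -> : (j + p.+1 - p.+1 = j)%N by lia.
  have -> : (n - (j + p.+1) = q - j.+1)%N by rewrite /q; lia.
  have -> : (n - j - p.+1 = q - j.+1)%N by rewrite /q; lia.
  have -> : (p < j + p.+1)%N by lia.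
  have -> : (p < n - j)%N by move: lt_jq; rewrite /q; lia.
  rewrite /= -mulnA [(c j * (_ * _))%N]mulnCA -mulnDl; congr (_ * _)%N.
  rewrite {}/b; move: (q) (nat_of_ord j) lt_jq => {}q {}j; clear; lia.
rewrite -big_distrr /=.
have -> : (r + n%:Z == p%:Z) = (r == - q%:Z) by rewrite /q; lia.
have : (\sum_(j < q) c j * c (q - j.+1) = (0 < q) * c q)%N.
  case: (q) => [|q']; first by rewrite big_ord0.
  by rewrite mul1n ballotS_conv; apply: eq_bigr => j _; rewrite subSS.
(* The separate term supplies the endpoint r = -q missing from [b]. *)
move=> ->; rewrite mulnA -mulnDl; congr (_ * _)%N; rewrite {}/b.
move: (q) => {}q; clear; lia.
Qed.

(** The cofactor of ['X - 1] in the formula for [E m r]; the sum is empty for |r| >= m, where no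
    position can be fixed. *)
Let D m r : {poly int} :=
  \sum_(p < m | (`|r| <= m - p.+1)%N) (c (m - p.+1))%:R * E p 0.

Let D_eq0 m r : (m <= `|r|)%N -> D m r = 0.
Proof. by move=> le_mr; apply: big_pred0 => p; have := ltn_ord p; lia. Qed.

Let D_widen n m r : (m <= n)%N ->
  D m r = \sum_(p < n)
    (((p < m) && (`|r| <= m - p.+1)) * c (m - p.+1))%N%:R * E p 0.
Proof.
move=> le_mn; rewrite /D.
rewrite (big_ord_widen_cond n (fun p => (`|r| <= m - p.+1)%N)
           (fun p => (c (m - p.+1))%:R * E p 0)) // big_mkcond /=.
apply: eq_bigr => p _; rewrite andbC.
by case: (_ && _); rewrite ?mul1n ?mul0r.
Qed.

(* In E_rec at most one of the three factors depends on x. *)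
Let E_term n k r (b := r + n%:Z == k%:Z) (s := r + (n - k)%N%:Z)
    (t := r - k.+1%:Z) :
  (k <= n)%N -> E k s = (c k)%:R + ('X - 1) * D k s ->
  E (n - k) t = (c (n - k))%:R + ('X - 1) * D (n - k) t ->
  'X^b * (E k s * E (n - k) t) = (c k * c (n - k))%N%:R + ('X - 1) *
    (D k s * (c (n - k))%:R + (c k)%:R * D (n - k) t
     + (b * c (n - k))%N%:R * E k 0).
Proof.
(* |s| < k forces r < 2k - n, hence t < k - n - 1 and |t| > n - k, so one of the two sums is
   empty. *)
move=> le_kn Es Et; have DD : D k s * D (n - k) t = 0.
  case: (leqP k `|s|) => [/D_eq0->|lt_s]; first by rewrite mul0r.
  by rewrite [X in _ * X]D_eq0 ?mulr0 // /t; move: lt_s; rewrite /s; lia.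
(* If [b] holds, then s = 0 and t = -(n + 1), and writing x as 1 + (x - 1) in front of [E k 0]
   yields the last summand. *)
have [/eqP b1|b0] := boolP b.
  have s0 : s = 0 by rewrite /s; lia.
  have Dt : D (n - k) t = 0 by apply: D_eq0; rewrite /t; lia.
  by rewrite Et Dt -s0 Es expr1 mul1n natrM; ring.
rewrite expr0 Es Et mul0n mul0r addr0 natrM mul1r.
transitivity ((c k)%:R * (c (n - k))%:R + ('X - 1) *
   (D k s * (c (n - k))%:R + (c k)%:R * D (n - k) t)
   + ('X - 1) ^+ 2 * (D k s * D (n - k) t)); first by ring.
by rewrite DD mulr0 addr0.
Qed.

(** Strong induction through [E_rec]: after [E_term] the cofactors of ['X - 1] are linear
    combinations of the [E p 0], and [ballot_coef] matches their coefficients. *)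
Lemma E_fixed n r :
  E n r = (c n)%:R + ('X - 1) *
    \sum_(p < n | (`|r| <= n - p.+1)%N) (c (n - p.+1))%:R * E p 0.
Proof.
rewrite -[\sum_(p < n | _) _]/(D n r).
elim/ltn_ind: n r => -[|n] IHn r.
  by rewrite E_avoiders big_seq1 /D big_ord0 mulr0 addr0.
rewrite E_rec.
under eq_bigr => k _.
  have lt_nk : (n - k < n.+1)%N by rewrite ltnS leq_subr.
  rewrite (E_term (ltn_ord k : (k <= n)%N) (IHn _ (ltn_ord k) _) (IHn _ lt_nk _)).
  by over.
rewrite big_split /= -natr_sum -ballotS_conv -mulr_sumr; congr (_ + _ * _).
rewrite big_split /=.
rewrite (eq_bigr (fun k : 'I_n.+1 => \sum_(p < n.+1)
    (((p < k) && (`|(r + (n - k)%N%:Z)%R| <= k - p.+1)) * c (k - p.+1) * c (n - k)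
      + c k * (((p < n - k) && (`|(r - k.+1%:Z)%R| <= n - k - p.+1))
               * c (n - k - p.+1)))%N%:R * E p 0)); last first.
  move=> k _; have le_kn := ltn_ord k.
  rewrite !(@D_widen n.+1); [|lia..].
  rewrite mulr_suml mulr_sumr -big_split /=; apply: eq_bigr => p _.
  by rewrite natrD !natrM; ring.
rewrite exchange_big -big_split (@D_widen n.+1) //=; apply: eq_bigr => p _.
rewrite -mulr_suml -mulrDl -natr_sum -natrD ballot_coef; last by rewrite -ltnS.
by rewrite subSS ltn_ord.
Qed.

(** At r = 0 the condition on p is vacuous, and p = n - 1 - j turns [E_fixed] into the recurrence
    [fix321_rec]. *)
Lemma E0_fix321 n : E n 0 = fix321 n.
Proof.
elim/ltn_ind: n => n IHn; rewrite E_fixed fix321_rec; congr (_ + _ * _).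
rewrite (reindex_inj rev_ord_inj) /=; apply: eq_big => [i|i _]; first by [].
rewrite IHn; last by have := ltn_ord i; lia.
by congr ((c _)%:R * _); have := ltn_ord i; lia.
Qed.

End Recurrences.

Theorem theorem5p1 (n r : nat) :
  E n r%:Z =
  a n%:Z + (1 - 'X) * \sum_(1 <= i < r.+1) (catalan i.-1)%:R * a (n%:Z - i%:Z).
Proof.
rewrite E_fixed /= fix321_rec big_add1 big_mkord /=.
have -> : \sum_(p < n | (r <= n - p.+1)%N) (ballot (n - p.+1) 0)%:R * E p 0 =
          \sum_(j < n | (r <= j)%N) (ballot j 0)%:R * fix321 (n - j.+1).
  rewrite (reindex_inj rev_ord_inj) /=; apply: eq_big => [j|j _].
    by congr (_ <= _)%N; have := ltn_ord j; lia.
  by rewrite E0_fix321; congr ((ballot _ 0)%:R * _); have := ltn_ord j; lia.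
have -> : \sum_(j < r) (catalan j)%:R * a (n%:Z - j.+1%:Z) =
          \sum_(j < n | (j < r)%N) (ballot j 0)%:R * fix321 (n - j.+1).
  (* Both sums are extended to j < n + r; for j >= n the index n - j - 1 is negative, where [a] is
     0. *)
  rewrite (big_ord_widen_cond (n + r) (fun j => (j < r)%N)
             (fun j => (ballot j 0)%:R * fix321 (n - j.+1))) ?leq_addr //.
  rewrite (big_ord_widen (n + r) (fun j => (catalan j)%:R * a (n%:Z - j.+1%:Z)))
          ?leq_addl //.
  rewrite big_mkcond [RHS]big_mkcond; apply: eq_bigr => j _.
  rewrite ballot_catalan; case: (j < r)%N => //=.
  case: (ltnP j n) => [lt_jn|le_nj].
    by have -> : n%:Z - j.+1%:Z = (n - j.+1)%N%:Z by lia.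
  have -> : n%:Z - j.+1%:Z = Negz (j - n) by rewrite NegzE; lia.
  by rewrite mulr0.
(* The sum for [a n] runs over all j < n; removing j < r leaves the terms r <= j of [E_fixed]. *)
rewrite (bigID (fun j : 'I_n => (r <= j)%N) xpredT) /=.
rewrite (eq_bigl (fun j : 'I_n => (j < r)%N) _ (fun j => esym (ltnNge j r))).
by ring.
Qed.
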